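(* Consider a Gaussian process model with a super-Gaussian likelihood: a prior $p(\boldsymbol f)=\mathcal N(\boldsymbol f\mid\boldsymbol\mu_0,K)$ on the latent values $\boldsymbol f=(f_1,\dots,f_n)\in\mathbb R^n$ at the $n$ data points, and, for targets $\boldsymbol y=(y_1,\dots,y_n)\in\mathbb R^n$, the likelihood $$p(\boldsymbol y\mid\boldsymbol f;\theta)=\prod_{i=1}^n C(\theta)\,e^{g(y_i;\theta) f_i}\,\varphi\big(\|h(f_i,y_i)\|_2^2\big),$$ where $\theta$ are hyperparameters, $C(\theta)$ is the normalizing constant, $g$ is an arbitrary function, $\varphi$ is a positive definite radial function, and $h$ is linear in $f_i$, so that $\|h(f_i,y_i)\|_2^2=\alpha(y_i,\theta)-\beta(y_i,\theta) f_i+\gamma(y_i,\theta)f_i^2$. This model is rendered conditionally conjugate by the auxiliary variable augmentation $$p(\boldsymbol y,\boldsymbol f,\boldsymbol\omega;\theta)=p(\boldsymbol y\mid\boldsymbol f,\boldsymbol\omega;\theta)\,p(\boldsymbol f)\,p(\boldsymbol\omega),\qquad \boldsymbol\omega=(\omega_1,\dots,\omega_n)\in[0,\infty)^n,$$ in which the augmented likelihood is $$p(\boldsymbol y\mid\boldsymbol f,\boldsymbol\omega;\theta)=\prod_{i=1}^n C(\theta)\exp\big(g(y_i;\theta) f_i-\|h(f_i,y_i)\|_2^2\,\omega_i\big)$$ and the prior distribution of the auxiliary variables is $$p(\boldsymbol\omega)=\prod_{i=1}^n\pi_\varphi(\omega_i\mid 0),\qquad \pi_\varphi(\omega\mid0)=\mathcal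 L^{-1}\{\varphi(\cdot)\}(\omega).$$
   Context: Here $\boldsymbol\mu_0\in\mathbb R^n$ is the prior mean and $K\in\mathbb R^{n\times n}$ is the (invertible) covariance matrix of the Gaussian process prior at the data points. The functions $\alpha,\beta,\gamma$ are the functions (otherwise arbitrary) appearing in the expansion of $\|h(f_i,y_i)\|_2^2$ as a quadratic in $f_i$. Positive definite radial function: $\varphi$ is a positive definite radial function if $\varphi(r)$ is completely monotone for all $r\ge0$ and $\lim_{r\to0}\varphi(r)=1$. Completely monotone means that $\varphi$ is infinitely differentiable with $(-1)^k\varphi^{(k)}(r)>0$ for $r\in[0,+\infty)$ and $k=0,1,2,\dots$. Inverse Laplace transform: $\mathcal L^{-1}$ is the inverse mapping of the Laplace transformation $\mathcal L\{p\}(r)=\int_0^\infty e^{-r\omega}p(\omega)\,d\omega$. It can be computed by the Bromwich integral $\mathcal L^{-1}\{\varphi(\cdot)\}(\omega)=\lim_{T\to\infty}\frac1{2\pi i}\int_{b-iT}^{b+iT}e^{r\omega}\varphi(r)\,dr$, where $b$ is larger than the real part of all singularities of $\varphi$. The function $\pi_\varphi(\cdot\mid0)=\mathcal L^{-1}\{\varphi(\cdot)\}$ is used as a probability density on $[0,\infty)$. For $c\in\mathbb R$ the exponentially tilted density is $$\pi_\varphi(\omega\mid c)=\frac{e^{-c^2\omega}\,\pi_\varphi(\omega\mid0)}{\varphi(c^2)}.$$ Auxiliary variable augmentation: auxiliary variables are added to the model in such a way that the original model is recovered when they are integrated out, i.e. $\int p(\boldsymbol y\mid\boldsymbol f,\boldsymbol\omega;\theta)\,p(\boldsymbol\omega)\,d\boldsymbol\omega=p(\boldsymbol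 y\mid\boldsymbol f;\theta)$. Conditionally conjugate: the complete conditional distributions $p(\boldsymbol f\mid\boldsymbol\omega,\boldsymbol y)$ and $p(\boldsymbol\omega\mid\boldsymbol f,\boldsymbol y)$ (the posterior of one variable given all the others) are in the same family as their associated priors. For $\boldsymbol f$ this is the family of Gaussian distributions. For each $\omega_i$ it is the family $\{\pi_\varphi(\cdot\mid c):c\in\mathbb R\}$.
   Formalization: The inverse Laplace transform of φ is assumed to exist as a function on [0,∞); this fails for some positive definite radial φ, e.g. φ(r)=exp(-r), whose inverse transform is a point mass. That it is a probability density is proved, not assumed. *)

(* Defs.v *)
From HB Require Import structures.
From mathcomp Require Import all_boot all_order all_algebra.
From mathcomp Require Import all_classical all_reals all_analysis.

Set Implicit Arguments.
Unset Strict Implicit.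
Unset Printing Implicit Defensive.

Import Order.TTheory GRing.Theory Num.Theory.
Import numFieldNormedType.Exports.

Local Open Scope classical_set_scope.
Local Open Scope ring_scope.

(* Lebesgue measure on R^n, points of R^n being n-tuples: the library provides
   the product sigma-algebra on tuples but no product measure, so the measure
   is built by recursion on n, as the image of lebesgue_measure \x lebesgue_n
   under (x, t) |-> x :: t. *)
Section cons_measure.
Context (R : realType) (n : nat).
Let T := measurableTypeR R.
Variable m : {sigma_finite_measure set (n.-tuple T) -> \bar R}.

Definition consT (p : T * n.-tuple T) : n.+1.-tuple T :=
  [the n.+1.-tuple T of p.1 :: p.2].

Lemma measurable_consT : measurable_fun [set: T * n.-tuple T] consT.
Proof. by apply: measurable_cons. Qed.

Definition cons_measure : set (n.+1.-tuple T) -> \bar R :=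
  pushforward (@lebesgue_measure R \x m)%E consT.

Let cons_measure0 : cons_measure set0 = 0%E.
Proof. by rewrite /cons_measure /pushforward preimage_set0 measure0. Qed.

Let cons_measure_ge0 A : (0 <= cons_measure A)%E.
Proof. by rewrite /cons_measure /pushforward; exact: measure_ge0. Qed.

Let cons_measure_sigma_additive : semi_sigma_additive cons_measure.
Proof.
move=> F mF tF mUF; rewrite /cons_measure /pushforward preimage_bigcup.
apply: measure_semi_sigma_additive.
- by move=> i; rewrite -[X in measurable X]setTI; exact: measurable_consT.
- apply/trivIsetP => /= i j _ _ ij; rewrite -preimage_setI.
  by move/trivIsetP : tF => /(_ _ _ _ _ ij) ->//; rewrite preimage_set0.
- by rewrite -preimage_bigcup -[X in measurable X]setTI; exact: measurable_consT.
Qed.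

HB.instance Definition _ := isMeasure.Build _ _ _ cons_measure
  cons_measure0 cons_measure_ge0 cons_measure_sigma_additive.

Let cons_measure_sigma_finite : sigma_finite [set: n.+1.-tuple T] cons_measure.
Proof.
have /sigma_finiteP[F [TF ndF Foo]] := sigma_finiteT (@lebesgue_measure R).
have /sigma_finiteP[G [TG ndG Goo]] := sigma_finiteT m.
pose uncons (t : n.+1.-tuple T) : T * n.-tuple T := (thead t, behead_tuple t).
have muncons : measurable_fun setT uncons.
  apply/measurable_fun_pairP; split.
    by apply: (measurable_tnth (T := T) ord0).
  exact: measurable_behead.
have unconsK p : uncons (consT p) = p.
  case: p => x t; rewrite /uncons /consT /=; congr pair.
  by apply/val_inj.
exists (fun i => uncons @^-1` (F i `*` G i)).
  rewrite -preimage_bigcup; apply/esym/seteqP; split => // t _ /=.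
  have : [set: T] (uncons t).1 by [].
  have : [set: n.-tuple T] (uncons t).2 by [].
  rewrite TF TG => -[k _ Gk] [j _ Fj]; exists (maxn j k) => //; split.
    by move: Fj; apply/subsetPset/ndF/leq_maxl.
  by move: Gk; apply/subsetPset/ndG/leq_maxr.
move=> i; have [mF Fi] := Foo i; have [mG Gi] := Goo i; split.
  by rewrite -[X in measurable X]setTI; apply: muncons => //; exact: measurableX.
rewrite /cons_measure /pushforward.
rewrite (_ : _ @^-1` _ = F i `*` G i); last first.
  by rewrite -comp_preimage (_ : uncons \o _ = id)//; exact/funext.
by rewrite product_measure1E// lte_mul_pinfty// ge0_fin_numE.
Qed.

HB.instance Definition _ := Measure_isSigmaFinite.Build _ _ _ cons_measure
  cons_measure_sigma_finite.

End cons_measure.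

Fixpoint lebesgue_n (R : realType) (n : nat) :
    {sigma_finite_measure set (n.-tuple (measurableTypeR R)) -> \bar R} :=
  match n with
  | 0 => \d_([tuple] : 0.-tuple (measurableTypeR R))
  | k.+1 => cons_measure (lebesgue_n R k)
  end.

Section positive_definite_radial.
Context (R : realType).
Implicit Types (phi p : R -> R).

(* Smoothness on the closed half-line: D k is the k-th derivative, taken
   within [0, +oo[, so that it is one-sided at 0 and the values of phi on
   negative reals are irrelevant. *)
Definition completely_monotone phi := exists D : nat -> R -> R,
  [/\ forall r, 0 <= r -> D 0%N r = phi r,
      forall k r, 0 <= r ->
        (D k s - D k r) / (s - r) @[s --> within `[0, +oo[ r^'] --> D k.+1 r
    & forall k r, 0 <= r -> 0 < (-1) ^+ k * D k r].

Definition positive_definite_radial phi :=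
  completely_monotone phi /\ phi r @[r --> 0^'+] --> (1 : R).

Definition laplace p (r : R) : R :=
  \int[lebesgue_measure]_(w in `[0, +oo[) (expR (- (r * w)) * p w).

(* The inverse Laplace transform of phi is a density determined up to a null
   set, hence a relation: p is a version of it. Nothing is required at r = 0,
   and p is neither assumed nonnegative nor of integral 1. *)
Definition is_inverse_laplace phi p :=
  measurable_fun (`[0, +oo[ : set R) p /\
  forall r, 0 < r ->
    lebesgue_measure.-integrable (`[0, +oo[ : set R)
      (fun w => (expR (- (r * w)) * p w)%:E) /\
    laplace p r = phi r.

Definition is_half_line_pdf p :=
  [/\ measurable_fun (`[0, +oo[ : set R) p,
      {ae lebesgue_measure, forall w : R, 0 <= w -> 0 <= p w}
    & (\int[lebesgue_measure]_(w in `[0%R, +oo[) (p w)%:E = 1)%E].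

Definition tilted phi p (c w : R) : R :=
  expR (- (c ^+ 2 * w)) * p w / phi (c ^+ 2).

End positive_definite_radial.

Section gaussian.
Context (R : realType) (n : nat).

Definition covariance_mx (S : 'M[R]_n) :=
  S^T = S /\ forall v : 'cV[R]_n, 0 <= (v^T *m S *m v) 0 0.

Definition gaussian_pdf (mu : 'cV[R]_n) (S : 'M[R]_n) (f : n.-tuple R) : R :=
  let v := \col_i tnth f i - mu in
  expR (- (v^T *m invmx S *m v) 0 0 / 2) / Num.sqrt ((2 * pi) ^+ n * \det S).

Definition gaussian_family : set (n.-tuple R -> R) :=
  [set q | exists mu S, [/\ covariance_mx S, S \in unitmx
                          & forall f, q f = gaussian_pdf mu S f]].

End gaussian.

Definition orthant (R : realType) n : set (n.-tuple R) :=
  [set w | forall i, 0 <= tnth w i].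

Definition tilted_family (R : realType) n (phi p : R -> R) :
    set (n.-tuple R -> R) :=
  [set q | exists c : 'I_n -> R, forall w, orthant w ->
     q w = \prod_i tilted phi p (c i) (tnth w i)].

Definition sqnorm2 (R : realType) d (v : 'rV[R]_d) : R := \sum_j v 0 j ^+ 2.

Section model.
Context (R : realType) (n d : nat) (Theta : Type).
Variables (C : Theta -> R) (g : R -> Theta -> R).
Variables (h : Theta -> R -> R -> 'rV[R]_d) (phi p : R -> R).
Variables (mu0 : 'cV[R]_n) (K : 'M[R]_n).
Implicit Types (theta : Theta) (y f w : n.-tuple R).

Definition likelihood1 theta (fi yi : R) : R :=
  C theta * expR (g yi theta * fi) * phi (sqnorm2 (h theta fi yi)).

Definition likelihood theta y f : R :=
  \prod_i likelihood1 theta (tnth f i) (tnth y i).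

Definition augmented_likelihood theta y f w : R :=
  \prod_i (C theta * expR (g (tnth y i) theta * tnth f i
             - sqnorm2 (h theta (tnth f i) (tnth y i)) * tnth w i)).

Definition aux_prior w : R := \prod_i p (tnth w i).

Definition augmented_joint theta y f w : R :=
  augmented_likelihood theta y f w * gaussian_pdf mu0 K f * aux_prior w.

End model.

(* For a joint density of (f, w), f ranging over R^n and w over the orthant. *)
Section conjugacy.
Context (R : realType) (n : nat).
Implicit Types (joint : n.-tuple R -> n.-tuple R -> R).

Definition conditional_f joint (w f : n.-tuple R) : R :=
  joint f w / \int[lebesgue_n R n]_f' joint f' w.

Definition conditional_w joint (f w : n.-tuple R) : R :=
  joint f w / \int[lebesgue_n R n]_(w' in @orthant R n) joint f w'.

(* p(f | w, y) is only defined where w has positive density; the prior of f is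
   a Gaussian density, so that no such restriction is needed for p(w | f, y). *)
Definition conditionally_conjugate
    (Ff Fw : set (n.-tuple R -> R)) (prior_f prior_w : n.-tuple R -> R) joint :=
  [/\ Ff prior_f, Fw prior_w,
      forall w, orthant w -> 0 < prior_w w -> Ff (conditional_f joint w)
    & forall f, Fw (conditional_w joint f)].

End conjugacy.

(* Main.v *)
(* Nothing in the hypotheses says that the inverse Laplace transform [p] of
   [phi] is nonnegative: as in Bernstein's theorem, this is forced by [phi].
   Complete monotonicity makes all finite differences of [phi] alternate in
   sign, i.e. the integral of [u * B * p] is nonnegative, where [u = exp (- w)]
   and [B] is any Bernstein polynomial in [u] with nonnegative coefficients.
   Bernstein polynomials of indicators of intervals converge boundedly to these
   indicators, so [u * p] has nonnegative integral over every interval, and [p]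
   is nonnegative almost everywhere by Lebesgue differentiation. Letting
   [r -> 0] in [laplace p r = phi r] gives total mass 1 by monotone convergence.

   The integral over the orthant of the augmented likelihood then factors into
   one-dimensional Laplace transforms, which gives back the likelihood and the
   tilted densities, with tilting parameters [sqrt (|| h ||^2)]. In [f], the
   augmented joint density is the exponential of a quadratic form with precision
   matrix [K^-1 + 2 diag (gamma w)]; its normalization is the multivariate
   Gaussian integral, obtained by integrating out one coordinate at a time and
   passing to the Schur complement. *)

Require Import Defs.
From HB Require Import structures.
From mathcomp Require Import all_boot all_order all_algebra.
From mathcomp Require Import all_classical all_reals all_analysis.
From mathcomp Require Import measurable_realfun ring lra.

Set Implicit Arguments.
Unset Strict Implicit.
Unset Printing Implicit Defensive.

Import Order.TTheory GRing.Theory Num.Theory.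
Import numFieldNormedType.Exports.

Local Open Scope classical_set_scope.
Local Open Scope ring_scope.

(** * Positivity of the inverse Laplace transform *)

(** Signs are weak, which makes the class stable under nonnegative scaling, and [x] is positive, so
    that two-sided derivatives suffice. *)
Definition cm_derivatives (R : realType) (D : nat -> R -> R) :=
  forall k (x : R), 0 < x ->
    is_derive x 1 (D k) (D k.+1 x) /\ 0 <= (-1) ^+ k * D k x.

(** Mean value theorem on [[x, x + 1]]: the derivative of [(-1) ^+ k * D k] is minus the nonnegative
    quantity of index [k.+1]. *)
Lemma cm_derivatives_le (R : realType) (D : nat -> R -> R) k (x : R) :
  cm_derivatives D -> 0 < x ->
  (-1) ^+ k * D k (x + 1) <= (-1) ^+ k * D k x.
Proof.
move=> cmD x0; have x1 : x < x + 1 by rewrite ltrDl.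
pose f := (-1) ^+ k \*: D k; pose df z := (-1) ^+ k *: D k.+1 z.
have dD z : x <= z -> is_derive z 1 f (df z).
  by move=> xz; have [dDk _] := cmD k _ (lt_le_trans x0 xz); exact: is_deriveZ.
have dD' z : z \in `]x, x + 1[ -> is_derive z 1 f (df z).
  by rewrite in_itv /= => /andP[/ltW xz _]; exact: dD.
have cf : {within `[x, x + 1], continuous f}.
  apply: derivable_within_continuous => z.
  by rewrite in_itv /= => /andP[xz _]; have := dD _ xz => -[].
have [z + e] := MVT x1 dD' cf.
rewrite in_itv /= => /andP[xz _].
rewrite -subr_le0 [leLHS]e addrAC subrr add0r mulr1.
have [_] := cmD k.+1 _ (lt_trans x0 xz).
by rewrite exprS mulN1r mulNr oppr_ge0.
Qed.

Lemma cm_derivatives_shift (R : realType) (D : nat -> R -> R) :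
  cm_derivatives D -> cm_derivatives (fun k x => D k (x + 1)).
Proof.
move=> cmD k x x0; have x10 : 0 < x + 1 by rewrite addr_gt0.
have [dD D0] := cmD k _ x10; split => //.
have dx : is_derive x 1 (fun x => x + 1) (1 + 0) by apply: is_deriveD.
have := is_derive1_comp (f := D k) (g := fun x => x + 1) dD dx.
by rewrite addr0 mulr1.
Qed.

Lemma cm_derivatives_diff (R : realType) (D : nat -> R -> R) :
  cm_derivatives D -> cm_derivatives (fun k x => D k x - D k (x + 1)).
Proof.
move=> cmD k x x0; split; last first.
  by rewrite mulrBr subr_ge0; exact: cm_derivatives_le.
have [dD _] := cmD k _ x0; have [dD' _] := cm_derivatives_shift cmD k x0.
exact: is_deriveB.
Qed.

Lemma cm_derivativesD (R : realType) (D E : nat -> R -> R) :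
  cm_derivatives D -> cm_derivatives E ->
  cm_derivatives (fun k x => D k x + E k x).
Proof.
move=> cmD cmE k x x0; have [dD D0] := cmD k _ x0; have [dE E0] := cmE k _ x0.
by split; [exact: is_deriveD | rewrite mulrDr addr_ge0].
Qed.

Lemma cm_derivativesZ (R : realType) (D : nat -> R -> R) (c : R) :
  0 <= c -> cm_derivatives D -> cm_derivatives (fun k x => c * D k x).
Proof.
move=> c0 cmD k x x0; have [dD D0] := cmD k _ x0.
by split; [exact: (is_deriveZ c) | rewrite mulrCA mulr_ge0].
Qed.

(** No sign is asked of [p]. The class is a cone stable under multiplication by [u = expR (- w)] and
    by [1 - u], the two weights in the recursion of [bernstein]. *)
Definition cm_laplace (R : realType) (p : R -> R) :=
  measurable_fun (`[0, +oo[ : set R) p /\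
  exists2 D, cm_derivatives D & forall r, 0 < r ->
    lebesgue_measure.-integrable (`[0, +oo[ : set R)
      (fun w => (expR (- (r * w)) * p w)%:E) /\
    laplace p r = D 0%N r.

Lemma measurable_expRM (R : realType) (D : set R) (r : R) :
  measurable_fun D (fun w => expR (- (r * w))).
Proof.
by apply: measurableT_comp => //; apply: measurableT_comp.
Qed.

(** Multiplying by [expR (- w)] translates the transform by 1. *)
Lemma cm_laplace_shift (R : realType) (p : R -> R) :
  cm_laplace p -> cm_laplace (fun w => expR (- w) * p w).
Proof.
move=> [mp [D cmD hD]]; split.
  by apply: measurable_funM => //; do 2 apply: measurableT_comp => //.
exists (fun k x => D k (x + 1)); first exact: cm_derivatives_shift.
move=> r r0; have [i1 l1] := hD _ (addr_gt0 r0 ltr01).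
have e w : expR (- (r * w)) * (expR (- w) * p w) = expR (- ((r + 1) * w)) * p w.
  by rewrite mulrA -expRD; congr (expR _ * _); ring.
split.
  apply: (@eq_integrable _ _ _ _ _ _ _ _ _ i1); first exact: measurable_itv.
  by move=> w _; exact: (congr1 EFin (esym (e w))).
by rewrite -l1 /laplace; apply: eq_Rintegral => w _; exact: e.
Qed.

Lemma cm_laplaceD (R : realType) (p q : R -> R) :
  cm_laplace p -> cm_laplace q -> cm_laplace (fun w => p w + q w).
Proof.
move=> [mp [D cmD hD]] [mq [E cmE hE]]; split; first exact: measurable_funD.
exists (fun k x => D k x + E k x); first exact: cm_derivativesD.
move=> r r0; have [ip lp] := hD _ r0; have [iq lq] := hE _ r0; split.
  apply: eq_integrable (integrableD _ ip iq) => // w _.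
  by rewrite mulrDr EFinD.
rewrite -lp -lq /laplace -RintegralD//.
by apply: eq_Rintegral => w _; rewrite mulrDr.
Qed.

Lemma cm_laplaceZ (R : realType) (p : R -> R) (c : R) :
  0 <= c -> cm_laplace p -> cm_laplace (fun w => c * p w).
Proof.
move=> c0 [mp [D cmD hD]]; split; first exact: measurable_funM.
exists (fun k x => c * D k x); first exact: cm_derivativesZ.
move=> r r0; have [ip lp] := hD _ r0; split.
  apply: eq_integrable (integrableZl _ c ip) => // w _.
  by rewrite mulrCA EFinM.
rewrite -lp /laplace -RintegralZl//.
by apply: eq_Rintegral => w _; rewrite mulrCA.
Qed.

(** The transform becomes [D 0 r - D 0 (r + 1)], whose derivatives keep alternating signs because
    each [(-1) ^+ k * D k] decreases over unit steps. *)
Lemma cm_laplace_diff (R : realType) (p : R -> R) :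
  cm_laplace p -> cm_laplace (fun w => (1 - expR (- w)) * p w).
Proof.
move=> cp; have [mq [E cmE hE]] := cm_laplace_shift cp.
move: cp => [mp [D cmD hD]]; split.
  apply: measurable_funM => //; apply: measurable_funB => //.
  by do 2 apply: measurableT_comp => //.
exists (fun k x => D k x - D k (x + 1)); first exact: cm_derivatives_diff.
move=> r r0; have [ip lp] := hD _ r0; have [iq lq] := hE _ r0.
have [_ lp1] := hD _ (addr_gt0 r0 ltr01); split.
  apply: eq_integrable (integrableB _ ip iq) => // w _.
  by rewrite mulrBl mul1r mulrBr EFinB.
rewrite -lp -lp1 /laplace.
have -> : \int[lebesgue_measure]_(w in `[0, +oo[)
      (expR (- ((r + 1) * w)) * p w) =
    \int[lebesgue_measure]_(w in `[0, +oo[)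
      (expR (- (r * w)) * (expR (- w) * p w)).
  apply: eq_Rintegral => w _.
  by rewrite [RHS]mulrA -expRD; congr (expR _ * _); ring.
rewrite -RintegralB//.
by apply: eq_Rintegral => w _; rewrite mulrBl mul1r mulrBr.
Qed.

(** * Bernstein polynomials *)

(* The value at [u] of the Bernstein operator of degree [n] applied to
   [k |-> a k], i.e. the mean of [a] under the binomial law with parameters
   [n] and [u]. *)
Fixpoint bernstein (R : realType) n (a : nat -> R) (u : R) : R :=
  if n is m.+1 then
    u * bernstein m (fun k => a k.+1) u + (1 - u) * bernstein m a u
  else a 0%N.

Lemma cm_laplace_bernstein (R : realType) (p : R -> R) n (a : nat -> R) :
  (forall k, 0 <= a k) -> cm_laplace p ->
  cm_laplace (fun w => bernstein n a (expR (- w)) * p w).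
Proof.
elim: n a p => [|n IHn] a p a0 cp /=; first exact: cm_laplaceZ.
(* Each weight is moved onto [p]: the induction hypothesis is used for [expR (- w) * p w] and for
   [(1 - expR (- w)) * p w]. *)
under eq_fun do rewrite mulrDl mulrAC [X in _ + X]mulrAC.
under eq_fun do rewrite mulrC [X in _ + X]mulrC.
apply: cm_laplaceD; apply: IHn => //.
  exact: cm_laplace_shift.
exact: cm_laplace_diff.
Qed.

(** The integral is the transform at [r = 1]. *)
Lemma cm_laplace_int_ge0 (R : realType) (p : R -> R) : cm_laplace p ->
  0 <= \int[lebesgue_measure]_(w in `[0, +oo[) (expR (- w) * p w).
Proof.
move=> [mp [D cmD hD]]; have [_] := hD _ ltr01; rewrite /laplace.
under eq_Rintegral do rewrite mul1r.
by move=> ->; have [_] := cmD 0%N _ ltr01; rewrite mul1r.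
Qed.

(** Second moment of a binomial variable about [c]: variance plus squared bias. In the induction, a
    success moves the centre to [c - 1]. *)
Lemma bernstein_sqr (R : realType) n (c u : R) :
  bernstein n (fun k => (k%:R - c) ^+ 2) u =
  n%:R * (u * (1 - u)) + (n%:R * u - c) ^+ 2.
Proof.
elim: n c => [|n IHn] c /=; first by ring.
have -> : (fun k : nat => (k.+1%:R - c) ^+ 2) = (fun k => (k%:R - (c - 1)) ^+ 2).
  by apply/funext => k; rewrite -natr1; congr (_ ^+ 2); ring.
by rewrite !IHn -natr1; ring.
Qed.

Lemma bernstein_le (R : realType) n (a b : nat -> R) (u : R) : 0 <= u <= 1 ->
  (forall k, a k <= b k) -> bernstein n a u <= bernstein n b u.
Proof.
move=> /andP[u0 u1]; elim: n a b => [|n IHn] a b ab //=.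
by apply: lerD; apply: ler_wpM2l => //; rewrite ?subr_ge0//; apply: IHn.
Qed.

Lemma bernsteinZ (R : realType) n (a : nat -> R) (c u : R) :
  bernstein n (fun k => c * a k) u = c * bernstein n a u.
Proof. by elim: n a => //= n IHn a; rewrite !IHn; ring. Qed.

Lemma bernsteinD (R : realType) n (a b : nat -> R) (u : R) :
  bernstein n (fun k => a k + b k) u = bernstein n a u + bernstein n b u.
Proof. by elim: n a b => //= n IHn a b; rewrite !IHn; ring. Qed.

Lemma bernstein_cst (R : realType) n (c u : R) :
  bernstein n (fun _ => c) u = c.
Proof. by elim: n => //= n ->; ring. Qed.

(** Chebyshev's argument: a deviation of [a k] from [L] is paid for by the squared distance of [k]
    to the mean [n%:R * u], whose average is the variance, at most [n%:R]. *)
Lemma bernstein_dist (R : realType) n (a : nat -> R) (L d u : R) :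
  0 <= d -> 0 <= u <= 1 ->
  (forall k, d * `|a k - L| <= (k%:R - n%:R * u) ^+ 2) ->
  d * `|bernstein n a u - L| <= n%:R.
Proof.
move=> d0 u01 ad.
have var : bernstein n (fun k => (k%:R - n%:R * u) ^+ 2) u <= n%:R.
  rewrite bernstein_sqr subrr expr0n addr0 ler_piMr//.
  move/andP : u01 => [u0 u1].
  by rewrite mulr_ile1// ?subr_ge0// gerBl.
(* The operator is linear and monotone, so the absolute value is reached by treating [s = d] and
   [s = - d] separately. *)
have bnd (s : R) : `|s| = d -> s * (bernstein n a u - L) <= n%:R.
  move=> sd; rewrite mulrBr -bernsteinZ -[s * L](bernstein_cst n _ u).
  rewrite -mulN1r -bernsteinZ -bernsteinD; apply: le_trans var.
  apply: bernstein_le => // k; apply: le_trans (ad k).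
  by rewrite mulN1r -mulrBr -sd -normrM ler_norm.
rewrite -[X in X * _](ger0_norm d0) -normrM ler_norml -lerNl; apply/andP; split.
  by rewrite -mulNr bnd// normrN ger0_norm.
by rewrite bnd// ger0_norm.
Qed.

Lemma le_near_itv (R : realType) (a t u : R) : `|t - u| < `|u - a| ->
  (a <= t) = (a <= u) /\ (t <= a) = (u <= a).
Proof.
have [au|ua] := lerP a u.
  rewrite ltr_norml => /andP[h1 h2].
  split; first by lra.
  by apply/idP/idP => ?; lra.
rewrite ltr_norml => /andP[h1 h2].
split; last by lra.
by apply/negbTE; rewrite -ltNge; lra.
Qed.

(** The indicator can differ at [k%:R / n.+1%:R] and at [u] only if these points are at least [d]
    apart; [bernstein_dist] then bounds the error by [1 / (d ^+ 2 * n.+1%:R)]. Excluding the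
    endpoints makes [d] positive. *)
Lemma bernstein_itv_cvg (R : realType) (a b u : R) :
  0 <= u <= 1 -> u != a -> u != b ->
  bernstein n.+1 (fun k => (a <= k%:R / n.+1%:R <= b)%R%:R) u @[n --> \oo] -->
  ((a <= u <= b)%R%:R : R).
Proof.
move=> u01 ua ub; set L := (a <= u <= b)%R%:R.
pose d := Num.min `|u - a| `|u - b|.
have d0 : 0 < d by rewrite lt_min !normr_gt0 !subr_eq0 ua.
have bnd n : `|L - bernstein n.+1 (fun k => (a <= k%:R / n.+1%:R <= b)%R%:R) u|
    <= (d ^+ 2)^-1 * n.+1%:R^-1.
  rewrite distrC ler_pdivlMl ?exprn_gt0//.
  have n0 : 0 < n.+1%:R :> R by [].
  rewrite -(ler_pM2l (exprn_gt0 2 n0)) mulrA.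
  rewrite (_ : n.+1%:R ^+ 2 * n.+1%:R^-1 = n.+1%:R); last first.
    by rewrite expr2 mulfK// gt_eqF.
  apply: bernstein_dist => //; first by rewrite mulr_ge0 ?sqr_ge0.
  move=> k; set t := k%:R / n.+1%:R.
  have -> : (k%:R - n.+1%:R * u) ^+ 2 = n.+1%:R ^+ 2 * `|t - u| ^+ 2.
    rewrite real_normK ?num_real// -exprMn; congr (_ ^+ 2).
    by rewrite mulrBr /t mulrCA mulfV ?mulr1// gt_eqF.
  rewrite -mulrA ler_pM2l ?exprn_gt0//.
  have [dtu|] := leP d `|t - u|.
    apply: (@le_trans _ _ (d ^+ 2)); last by rewrite ler_sqr ?nnegrE// ltW.
    rewrite ler_piMr ?sqr_ge0// /L.
    by case: (a <= t <= b); case: (a <= u <= b);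
      rewrite ?subrr ?subr0 ?sub0r ?normrN ?normr1 ?normr0.
  rewrite lt_min => /andP[/le_near_itv[ta _] /le_near_itv[_ tb]].
  by rewrite ta tb subrr normr0 mulr0 sqr_ge0.
apply/cvgrPdist_lt => e e0.
have ed : 0 < e * d ^+ 2 by rewrite mulr_gt0 ?exprn_gt0.
near=> n; apply: le_lt_trans (bnd n) _.
rewrite ltr_pdivrMl ?exprn_gt0// mulrC.
by near: n; exact: (near_infty_natSinv_lt (PosNum ed)).
Unshelve. all: by end_near. Qed.

Lemma measurable_bernstein (R : realType) (D : set R) n (a : nat -> R)
    (f : R -> R) :
  measurable_fun D f -> measurable_fun D (fun w => bernstein n a (f w)).
Proof.
move=> mf; elim: n a => [|n IHn] a /=; first exact: measurable_cst.
by apply: measurable_funD; apply: measurable_funM => //; exact: measurable_funB.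
Qed.

Lemma bernstein01 (R : realType) n (a : nat -> R) (u : R) : 0 <= u <= 1 ->
  (forall k, 0 <= a k <= 1) -> 0 <= bernstein n a u <= 1.
Proof.
move=> u01 a01; rewrite -[X in X <= _ <= _](bernstein_cst n 0 u).
rewrite -[X in _ <= _ <= X](bernstein_cst n 1 u).
by rewrite !bernstein_le// => k; case/andP : (a01 k).
Qed.

Lemma expRN_itv01 (R : realType) (w : R) : 0 <= w -> 0 <= expR (- w) <= 1.
Proof. by move=> w0; rewrite expR_ge0 -expR0 ler_expR oppr_le0. Qed.

Lemma EFin_Rintegral d (T : measurableType d) (R : realType)
    (mu : {measure set T -> \bar R}) (D : set T) (f : T -> R) :
  measurable D -> mu.-integrable D (EFin \o f) ->
  (\int[mu]_(x in D) f x)%:E = (\int[mu]_(x in D) (f x)%:E)%E.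
Proof. by move=> mD intf; rewrite fineK//; exact: integrable_fin_num. Qed.

Lemma cm_laplace_integrable (R : realType) (p : R -> R) : cm_laplace p ->
  lebesgue_measure.-integrable (`[0, +oo[ : set R)
    (EFin \o (fun w => expR (- w) * p w)).
Proof.
move=> [_ [D _ /(_ _ ltr01)[+ _]]].
by apply: eq_integrable => // w _; rewrite mul1r.
Qed.

Lemma cm_laplace_itv_ge0 (R : realType) (p : R -> R) (x y : R) :
  cm_laplace p -> 0 <= x -> x <= y ->
  (0 <= \int[lebesgue_measure]_(w in `[x, y]) (expR (- w) * p w)%:E)%E.
Proof.
move=> cp x0 xy; have ip := cm_laplace_integrable cp.
have mp := measurable_int _ ip.
(* Since [w |-> expR (- w)] decreases, [[x, y]] becomes [[expR (- y), expR (- x)]], whose indicator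
   is sampled on the grid of step [1 / n.+1]. *)
pose a n k : R := (expR (- y) <= k%:R / n.+1%:R <= expR (- x))%R%:R.
have a01 n k : 0 <= a n k <= 1 by rewrite ler0n lern1 leq_b1.
pose q w := expR (- w) * p w.
pose f n w := (bernstein n.+1 (a n) (expR (- w)) * q w)%:E.
pose g w := ((expR (- y) <= expR (- w) <= expR (- x))%R%:R * q w)%:E.
have gE : g = (EFin \o q) \_ `[x, y].
  apply/funext => w; rewrite /g /patch !ler_expR !lerN2 andbC mem_setE in_itv /=.
  by case: ifPn => _; rewrite ?mul1r ?mul0r.
have ge0 n : (0 <= \int[lebesgue_measure]_(w in `[0%R, +oo[) f n w)%E.
  have a0 k : 0 <= a n k by have /andP[] := a01 n k.
  have cq := cm_laplace_bernstein n.+1 a0 cp.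
  have := cm_laplace_int_ge0 cq.
  rewrite -lee_fin EFin_Rintegral//; last exact: cm_laplace_integrable cq.
  by under eq_integral do rewrite mulrCA.
have [| | | | |_ _ cvgf] := @dominated_convergence _ _ _ lebesgue_measure
    `[0%R, +oo[ (measurable_itv _) f g (abse \o (EFin \o q)).
- move=> n; apply/measurable_EFinP; apply: measurable_funM.
    by apply: measurable_bernstein; do 2 apply: measurableT_comp => //.
  exact/measurable_EFinP.
- rewrite gE; apply/(measurable_restrict _ _ _) => //.
  by apply: measurable_funS mp => // w [].
(* Pointwise convergence may fail only where [expR (- w)] hits an endpoint. *)
- exists ([set x] `|` [set y]); split.
  + exact: measurableU.
  + by rewrite null_set_setU//; exact: lebesgue_measure_set1.
  + move=> w; apply: contra_notP => /not_orP[/= wx wy] w0.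
    move: w0; rewrite in_itv /= andbT => w0.
    apply: cvg_EFin; first exact: nearW.
    apply: cvgMr_tmp; apply: bernstein_itv_cvg.
    * exact: expRN_itv01.
    * by apply/eqP => /expR_inj /oppr_inj.
    * by apply/eqP => /expR_inj /oppr_inj.
- exact: integrable_abse.
- apply: aeW => w n; rewrite /= in_itv /= andbT => w0.
  have /andP[b0 b1] := bernstein01 n.+1 (expRN_itv01 w0) (a01 n).
  by rewrite lee_fin normrM ger0_norm// ler_piMl.
have : (0 <= \int[lebesgue_measure]_(w in `[0%R, +oo[) g w)%E.
  by apply: cvge_ge cvgf; exact: nearW.
rewrite gE -integral_mkcondr (_ : _ `&` _ = `[x, y]%classic)//.
by apply/setIidPr => w; rewrite /= !in_itv /= andbT => /andP[/(le_trans x0)].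
Qed.

Lemma cm_laplace_ae_ge0 (R : realType) (p : R -> R) : cm_laplace p ->
  {ae lebesgue_measure, forall w : R, 0 <= w -> 0 <= p w}.
Proof.
move=> cp; have ip := cm_laplace_integrable cp.
pose q w := expR (- w) * p w.
(* Intervals to the right of [x], rather than balls, stay inside the half-line even for [x = 0]. *)
pose E (x : R) (n : nat) : set R := `[x, x + n.+1%:R^-1]%classic.
have hE x : nicely_shrinking x (E x).
  split; first by move=> n; exact: measurable_itv.
  (* The open ball of radius [2 / n.+1] contains the closed interval [E x n] and has measure
     [4 / n.+1], four times its length. *)
  exists (4, fun n => PosNum (mulr_gt0 (ltr0Sn R 1) (harmonic_gt0 n))); split => //=.
  - by rewrite -[X in _ --> X](mulr0 2); apply: cvgMl_tmp; exact: cvg_harmonic.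
  - move=> n w; rewrite /E /ball /= in_itv /= => /andP[xw wx].
    have n0 : 0 < n.+1%:R^-1 :> R by rewrite invr_gt0.
    rewrite /harmonic /=; move: (n.+1%:R^-1) n0 wx => e e0 wx.
    by rewrite ltr_norml; apply/andP; split; lra.
  - move=> n; have n0 : 0 < n.+1%:R^-1 :> R by rewrite invr_gt0.
    rewrite lebesgue_measure_ball; last by rewrite mulr_ge0// ltW.
    rewrite /E lebesgue_measure_itv /= lte_fin ltrDl n0 -EFinB -EFinM lee_fin.
    by rewrite /harmonic; move: (n.+1%:R^-1) n0 => e e0; lra.
have locq := integrable_locally (measurable_itv `[0, +oo[) ip.
have := lebesgue_differentiation locq.
apply: (@filterS _ _ (ae_filter_ringOfSetsType _)) => x.
move=> /(nice_lebesgue_differentiation hE locq) cvgq x0.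
have : (0%R <= ((q \_ `[0%R, +oo[) x)%:E)%E.
  apply: cvge_ge cvgq; apply: nearW => n.
  rewrite mule_ge0 ?inve_ge0//.
  have -> : (\int[lebesgue_measure]_(y in E x n) ((q \_ `[0%R, +oo[) y)%:E =
      \int[lebesgue_measure]_(y in E x n) (expR (- y) * p y)%:E)%E.
    apply: eq_integral => y; rewrite inE /E /= in_itv /= => /andP[xy _].
    by rewrite patchE mem_setE in_itv /= (le_trans x0 xy).
  by apply: cm_laplace_itv_ge0 => //; rewrite lerDl invr_ge0.
by rewrite patchE mem_setE in_itv /= x0 lee_fin pmulr_rge0// expR_gt0.
Qed.

(** * Behaviour at the origin and total mass *)

Lemma completely_monotone_cm_derivatives (R : realType) (phi : R -> R) :
  completely_monotone phi ->
  exists2 D, cm_derivatives D & forall r, 0 < r -> D 0%N r = phi r.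
Proof.
move=> [D [D0 dD Dpos]]; exists D; last by move=> r /ltW; exact: D0.
move=> k r r0; split; last exact/ltW/Dpos/ltW.
have dDr : h^-1 *: (D k (h *: 1 + r) - D k r) @[h --> 0^'] --> D k.+1 r.
  apply/cvgrPdist_lt => e e0.
  have /cvgrPdist_lt /(_ _ e0) [d /= d0 H] := dD k r (ltW r0).
  (* Increments smaller than [r] keep [h + r] in the half-line, so the derivative within it is the
     two-sided one. *)
  exists (Num.min d r) => /=; first by rewrite lt_min d0.
  move=> h; rewrite /ball /= sub0r normrN lt_min => /andP[hd hr] h0.
  have := H (h + r); rewrite addrK /ball /= opprD addrCA subrr addr0 normrN.
  rewrite [_%:A]mulr1 [_ *: _]mulrC; apply => //.
    by rewrite -[X in _ != X]add0r (inj_eq (addIr _)).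
  by rewrite in_itv /= andbT; move: hr; rewrite ltr_norml; lra.
apply: DeriveDef; first by apply/cvg_ex; exists (D k.+1 r).
by apply/cvg_lim => //; exact: Rhausdorff.
Qed.

(** The difference quotient at 0 has a finite limit, so its product with [x] tends to 0. *)
Lemma completely_monotone_cvg0 (R : realType) (phi : R -> R) :
  completely_monotone phi -> phi r @[r --> 0^'+] --> phi 0.
Proof.
move=> [D [D0 dD _]]; have := dD 0%N 0 (lexx 0).
have le0 : (0 : R)^'+ `=>` within `[0, +oo[ (0 : R)^'.
  move=> A [e /= e0 H]; exists e => //= x xe x0; apply: H => //=.
    by rewrite gt_eqF.
  by rewrite in_itv /= andbT ltW.
move=> /(cvg_trans (cvg_app _ le0)) cq.
have cid0 : x @[x --> (0 : R)^'+] --> (0 : R).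
  exact: cvg_within_filter.
have := cvgD (cvgM cq cid0) (cvg_cst (D 0%N 0)).
rewrite mulr0 add0r => /(_ _ _ _) cD; rewrite -D0//.
refine (cvg_trans _ cD); apply: near_eq_cvg.
near=> x; have x0 : 0 < x by near: x; exact: nbhs_right_gt.
rewrite -D0 ?(ltW x0)//.
change ((D 0%N x - D 0%N 0) / (x - 0) * x + D 0%N 0 = D 0%N x).
by rewrite subr0 divfK ?gt_eqF// subrK.
Unshelve. all: by end_near. Qed.

Lemma positive_definite_radial0 (R : realType) (phi : R -> R) :
  positive_definite_radial phi -> phi 0 = 1.
Proof.
move=> [/completely_monotone_cvg0 c0 c1].
exact: (cvg_unique (@Rhausdorff R) c0 c1).
Qed.

Lemma positive_definite_radial_gt0 (R : realType) (phi : R -> R) (r : R) :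
  positive_definite_radial phi -> 0 <= r -> 0 < phi r.
Proof.
by move=> [[D [D0 _ Dpos]] _] r0; have := Dpos 0%N _ r0; rewrite mul1r D0.
Qed.

Lemma inverse_laplace_cm_laplace (R : realType) (phi p : R -> R) :
  completely_monotone phi -> is_inverse_laplace phi p -> cm_laplace p.
Proof.
move=> /completely_monotone_cm_derivatives[D cmD Dphi] [mp lp]; split => //.
by exists D => // r r0; have [ip ->] := lp _ r0; rewrite Dphi.
Qed.

Lemma inverse_laplace_pdf (R : realType) (phi p : R -> R) :
  positive_definite_radial phi -> is_inverse_laplace phi p ->
  is_half_line_pdf p.
Proof.
move=> phi_pdr pinv; have [mp lp] := pinv; have [cm phi1] := phi_pdr.
have p0 := cm_laplace_ae_ge0 (inverse_laplace_cm_laplace cm pinv).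
split => //.
pose D : set R := `[0, +oo[%classic.
(* Monotone convergence is applied to functions nonnegative everywhere, so [p] gives way to its
   positive part, almost everywhere equal to it on [D]. *)
pose pp w := Num.max (p w) 0.
have pE : ae_eq lebesgue_measure D p pp.
  apply: (@filterS _ _ (ae_filter_ringOfSetsType _)) p0 => w w0.
  by rewrite /D /= in_itv /= andbT => /w0 pw; rewrite /pp max_l.
have pp0 w : 0 <= pp w by rewrite le_max lexx orbT.
have mpp : measurable_fun D pp by apply: measurable_maxr.
(* Along [r = 1 / n.+1] the integrands increase to [pp], and their integrals are values of [phi]
   tending to 1. *)
pose f n w := (expR (- (n.+1%:R^-1 * w)) * pp w)%:E.
have mf n : measurable_fun D (f n).
  apply/measurable_EFinP; apply: measurable_funM => //; exact: measurable_expRM.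
have intf n : (\int[lebesgue_measure]_(w in D) f n w)%E = (phi n.+1%:R^-1)%:E.
  have n0 : 0 < n.+1%:R^-1 :> R by rewrite invr_gt0.
  have [ip <-] := lp _ n0; rewrite /laplace EFin_Rintegral//.
  apply: ae_eq_integral; [exact: measurable_itv|exact: mf|exact: measurable_int ip|].
  apply: (@filterS _ _ (ae_filter_ringOfSetsType _)) pE => w /= pw Dw.
  by rewrite /f pw.
have cvgf w : D w -> f n w @[n --> \oo] --> (pp w)%:E.
  move=> _; apply: cvg_EFin; first exact: nearW.
  have : expR (- (n.+1%:R^-1 * w)) @[n --> \oo] --> expR (- (0 * w)).
    apply: continuous_cvg; first exact: continuous_expR.
    by apply: cvgN; apply: cvgMr_tmp; exact: cvg_harmonic.
  rewrite mul0r oppr0 expR0 => cexp.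
  by rewrite -[X in _ --> X]mul1r; apply: cvgMr_tmp.
have -> : (\int[lebesgue_measure]_(w in D) (p w)%:E)%E =
    (\int[lebesgue_measure]_(w in D) limn (f ^~ w))%E.
  transitivity (\int[lebesgue_measure]_(w in D) (pp w)%:E)%E.
    apply: ae_eq_integral; [exact: measurable_itv|exact/measurable_EFinP..|].
    by apply: (@filterS _ _ (ae_filter_ringOfSetsType _)) pE => w /= pw /pw ->.
  apply: eq_integral => w; rewrite inE => Dw.
  by apply/esym/cvg_lim => //; exact: cvgf.
have := @cvg_monotone_convergence _ _ _ lebesgue_measure D (measurable_itv _) f mf.
have f0 n x : D x -> (0 <= f n x)%E.
  by move=> _; rewrite lee_fin mulr_ge0 ?expR_ge0.
have ndf x : D x -> {homo f ^~ x : n m / (n <= m)%N >-> (n <= m)%E}.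
  rewrite /D /= in_itv /= andbT => x0 n m nm.
  rewrite lee_fin ler_wpM2r// ler_expR lerN2 ler_wpM2r//.
  by rewrite lef_pV2 ?posrE// ler_nat ltnS.
move=> /(_ f0 ndf) cvg1.
have cvg2 : (\int[lebesgue_measure]_(w in D) f n w)%E @[n --> \oo] --> 1%E.
  under eq_fun do rewrite intf.
  apply: cvg_EFin; first exact: nearW.
  have /cvg_at_rightP := phi1; apply; split; last exact: cvg_harmonic.
  by move=> n; rewrite invr_gt0.
exact: (cvg_unique _ cvg1 cvg2).
Qed.

(** The inverse transform is unconstrained at [r = 0]; there the identity comes from total mass 1
    and [phi 0 = 1]. This case arises when [h] vanishes. *)
Lemma inverse_laplace_ge0 (R : realType) (phi p : R -> R) (r : R) :
  positive_definite_radial phi -> is_inverse_laplace phi p -> 0 <= r ->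
  lebesgue_measure.-integrable (`[0, +oo[ : set R)
    (fun w => (expR (- (r * w)) * p w)%:E) /\
  (\int[lebesgue_measure]_(w in `[0%R, +oo[) (expR (- (r * w)) * p w)%:E)%E =
    (phi r)%:E.
Proof.
move=> phi_pdr pinv; have [_ lp] := pinv.
rewrite le_eqVlt => /predU1P[<-|r0]; last first.
  by have [ip <-] := lp _ r0; rewrite /laplace EFin_Rintegral.
have [mp p0 p1] := inverse_laplace_pdf phi_pdr pinv.
have e0 w : expR (- (0 * w)) * p w = p w by rewrite mul0r oppr0 expR0 mul1r.
under eq_integral do rewrite e0.
rewrite (positive_definite_radial0 phi_pdr); split => //.
have -> : (fun w => (expR (- (0 * w)) * p w)%:E) = EFin \o p.
  by apply/funext => w; rewrite e0.
apply/integrableP; split; first exact/measurable_EFinP.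
suff -> : (\int[lebesgue_measure]_(w in `[0%R, +oo[) `|(EFin \o p) w|)%E = 1%E.
  exact: ltry.
rewrite -p1; apply: ae_eq_integral; first exact: measurable_itv.
- by apply: measurableT_comp => //; exact/measurable_EFinP.
- exact/measurable_EFinP.
apply: (@filterS _ _ (ae_filter_ringOfSetsType _)) p0 => w /= w0.
by rewrite in_itv /= andbT => /w0 pw; rewrite ger0_norm.
Qed.

(** * Integration on [R^n] *)

Lemma tnth_consT (R : realType) (n : nat)
    (p : measurableTypeR R * n.-tuple (measurableTypeR R)) (i : 'I_n.+1) :
  tnth (consT p) i =
  if unlift ord0 i is Some j then tnth p.2 j else p.1.
Proof.
case: unliftP => [j ->|->]; first exact: tnthS.
exact: tnth0.
Qed.

Lemma integrable_prodM d1 d2 (T1 : measurableType d1) (T2 : measurableType d2)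
    (R : realType) (m1 : {sigma_finite_measure set T1 -> \bar R})
    (m2 : {sigma_finite_measure set T2 -> \bar R}) (f : T1 -> R) (g : T2 -> R) :
  m1.-integrable setT (EFin \o f) -> m2.-integrable setT (EFin \o g) ->
  (m1 \x m2)%E.-integrable setT (fun z => (f z.1 * g z.2)%:E).
Proof.
move=> intf intg.
have mf : measurable_fun setT f by exact/measurable_EFinP/(measurable_int _ intf).
have mg : measurable_fun setT g by exact/measurable_EFinP/(measurable_int _ intg).
apply/integrable12ltyP.
  by apply/measurable_EFinP; apply: measurable_funM; exact: measurableT_comp.
have /integrableP[_ foo] := intf; have /integrableP[_ goo] := intg.
under eq_integral.
  move=> x _ /=.
  under eq_integral do rewrite normrM EFinM.
  rewrite ge0_integralZl_EFin//; last first.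
    by apply/measurable_EFinP; exact: measurableT_comp.
  over.
rewrite /=; have gfin : (\int[m2]_y `|(g y)%:E|)%E \is a fin_num.
  by rewrite ge0_fin_numE// integral_ge0.
under eq_integral do rewrite -(fineK gfin) muleC.
rewrite ge0_integralZl_EFin//.
- rewrite lte_mul_pinfty// lee_fin fine_ge0// integral_ge0//.
- by apply/measurable_EFinP; exact: measurableT_comp.
- by rewrite fine_ge0// integral_ge0.
Qed.

Lemma integral_prodM d1 d2 (T1 : measurableType d1) (T2 : measurableType d2)
    (R : realType) (m1 : {sigma_finite_measure set T1 -> \bar R})
    (m2 : {sigma_finite_measure set T2 -> \bar R}) (f : T1 -> R) (g : T2 -> R) :
  m1.-integrable setT (EFin \o f) -> m2.-integrable setT (EFin \o g) ->
  (\int[(m1 \x m2)%E]_z (f z.1 * g z.2)%:E =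
   \int[m1]_x (f x)%:E * \int[m2]_y (g y)%:E)%E.
Proof.
move=> intf intg; rewrite -integral12_prod_meas1; last exact: integrable_prodM.
have gfin := integrable_fin_num measurableT intg.
rewrite /fubini_F; under eq_integral.
  move=> x _ /=; under eq_integral do rewrite EFinM.
  rewrite integralZl//; over.
by rewrite /= -(fineK gfin) integralZr.
Qed.

(** Induction on [n]: pulled back along [consT], the product splits into a factor in the first
    coordinate and a product over the others, and Fubini's theorem applies. For [n = 0] the Dirac
    mass gives the empty product. *)
Lemma lebesgue_n_prod (R : realType) (n : nat) (F : 'I_n -> R -> R) :
  (forall i, lebesgue_measure.-integrable setT (EFin \o F i)) ->
  (lebesgue_n R n).-integrable setT (fun t => (\prod_i F i (tnth t i))%:E) /\
  (\int[lebesgue_n R n]_t (\prod_i F i (tnth t i))%:E)%E =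
    (\prod_i fine (\int[lebesgue_measure]_x (F i x)%:E)%E)%:E.
Proof.
elim: n F => [|n IHn] F intF.
  have -> : (fun t : 0.-tuple (measurableTypeR R) => (\prod_i F i (tnth t i))%:E) =
      cst 1%:E by apply/funext => t; rewrite big_ord0.
  split; last by rewrite integral_cst// mul1e big_ord0 /= diracT.
  apply/integrableP; split; first exact: measurable_cst.
  under eq_integral do rewrite /= normr1.
  by rewrite integral_cst//= diracT mule1 ltry.
have [intG G] := IHn (fun i => F (lift ord0 i)) (fun i => intF _).
have mF i : measurable_fun setT (F i).
  by have /measurable_int/measurable_EFinP := intF i.
have mP : measurable_fun setT
    (fun t : n.+1.-tuple (measurableTypeR R) => (\prod_i F i (tnth t i))%:E).
  apply/measurable_EFinP; apply: measurable_prod => i _.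
  exact: (measurableT_comp (mF i) (measurable_tnth i)).
pose g (t : n.-tuple (measurableTypeR R)) := \prod_i F (lift ord0 i) (tnth t i).
have PE : (fun t : n.+1.-tuple (measurableTypeR R) => (\prod_i F i (tnth t i))%:E) \o
    @consT R n = (fun z => (F ord0 z.1 * g z.2)%:E).
  apply/funext => z /=; rewrite big_ord_recl tnth_consT unlift_none.
  by congr (_ * _)%:E; apply: eq_bigr => i _; rewrite tnth_consT liftK.
have intP := integrable_prodM (intF ord0) intG.
have intP' : (lebesgue_measure \x lebesgue_n R n)%E.-integrable (@consT R n @^-1` setT)
    ((fun t : n.+1.-tuple (measurableTypeR R) => (\prod_i F i (tnth t i))%:E) \o
      @consT R n).
  by rewrite PE preimage_setT.
split.
  exact: (integrable_pushforward (@measurable_consT R n) mP intP').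
transitivity (\int[(lebesgue_measure \x lebesgue_n R n)%E]_z
    (F ord0 z.1 * g z.2)%:E)%E.
  have := integral_pushforward (@measurable_consT R n) mP intP' measurableT.
  by rewrite PE preimage_setT.
rewrite (integral_prodM (intF ord0) intG) G big_ord_recl EFinM fineK//.
exact: (integrable_fin_num measurableT (intF ord0)).
Qed.

(** The indicator of the orthant is a product of indicators of half-lines, so each [F i] is extended
    by 0 to the whole line. *)
Lemma lebesgue_n_prod_orthant (R : realType) (n : nat) (F : 'I_n -> R -> R)
    (c : 'I_n -> R) (k : R) :
  (forall i, lebesgue_measure.-integrable (`[0, +oo[ : set R) (EFin \o F i)) ->
  (forall i, \int[lebesgue_measure]_(x in `[0%R, +oo[) (F i x)%:E = (c i)%:E)%E ->
  (\int[lebesgue_n R n]_(t in @orthant R n) (k * \prod_i F i (tnth t i))%:E)%E =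
    (k * \prod_i c i)%:E.
Proof.
move=> intF Fc; pose G i := F i \_ `[0, +oo[.
have intG i : lebesgue_measure.-integrable setT (EFin \o G i).
  rewrite /G -restrict_EFin.
  have [intFr _] := @integrable_mkcond _ _ R lebesgue_measure `[0, +oo[%classic
    (EFin \o F i) (measurable_itv _).
  exact: intFr.
have [intGn GE] := lebesgue_n_prod intG.
rewrite integral_mkcond; transitivity
    (\int[lebesgue_n R n]_t (k%:E * (\prod_i G i (tnth t i))%:E))%E.
  apply: eq_integral => t _; rewrite patchE.
  case: ifPn => [|]; rewrite ?inE ?notin_setE.
    move=> t0; rewrite -EFinM; congr (_ * _)%:E; apply: eq_bigr => i _.
    by rewrite /G patchE mem_set//= in_itv /= andbT; exact: t0.
  move=> /existsNP[i /negP t0].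
  rewrite (bigD1 i)//= /G patchE memNset ?mul0r ?mule0//.
  by rewrite /= in_itv /= andbT; exact/negP.
rewrite integralZl// GE -EFinM; congr (_ * _)%:E; apply: eq_bigr => i _.
rewrite -[RHS]/(fine (c i)%:E) -Fc [in RHS]integral_mkcond; congr fine.
by apply: eq_integral => x _; rewrite /G !patchE; case: ifP.
Qed.

(** * Gaussian densities *)

(** Strict counterpart of [covariance_mx], meant for precision matrices. *)
Definition posdef (R : realType) n (A : 'M[R]_n) :=
  A^T = A /\ forall v : 'cV[R]_n, v != 0 -> 0 < (v^T *m A *m v) 0 0.

Lemma quad_block (R : realType) n (a z : R) (b u : 'cV[R]_n)
    (B : 'M[R]_n) :
  ((col_mx z%:M u)^T *m block_mx a%:M b^T b B *m col_mx z%:M u) 0 0 =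
  a * z ^+ 2 + 2 * z * (b^T *m u) 0 0 + (u^T *m B *m u) 0 0.
Proof.
have D (X Y : 'M[R]_1) : (X + Y) 0 0 = X 0 0 + Y 0 0 by rewrite mxE.
have Z c (X : 'M[R]_1) : (c *: X) 0 0 = c * X 0 0 by rewrite mxE.
have S (c : R) : (c%:M : 'M[R]_1) 0 0 = c by rewrite mxE.
rewrite tr_col_mx mul_row_block mul_row_col tr_scalar_mx.
rewrite !mulmxDl !mul_scalar_mx -!scalemxAl !mul_mx_scalar !D !Z S.
have -> : (u^T *m b) 0 0 = (b^T *m u) 0 0.
  by rewrite -[in LHS](trmxK b) -trmx_mul mxE.
by ring.
Qed.

Definition schur (R : realType) n (a : R) (b : 'cV[R]_n) (B : 'M[R]_n) :=
  B - a^-1 *: (b *m b^T).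

(** Completing the square in the first coordinate [z]. *)
Lemma schurE (R : realType) n (a z : R) (b u : 'cV[R]_n) (B : 'M[R]_n) :
  a != 0 ->
  ((col_mx z%:M u)^T *m block_mx a%:M b^T b B *m col_mx z%:M u) 0 0 =
  a * (z + (b^T *m u) 0 0 / a) ^+ 2 + (u^T *m schur a b B *m u) 0 0.
Proof.
move=> a0; rewrite quad_block /schur mulmxBr mulmxBl.
rewrite -scalemxAr -scalemxAl mulmxA -[u^T *m b *m b^T *m u]mulmxA.
rewrite [u^T *m b]mx11_scalar mul_scalar_mx.
have -> : (u^T *m b) 0 0 = (b^T *m u) 0 0.
  by rewrite -[in LHS](trmxK b) -trmx_mul mxE.
set c := (b^T *m u) 0 0; set Q := u^T *m B *m u.
have -> : (Q - a^-1 *: (c *: (b^T *m u))) 0 0 = Q 0 0 - a^-1 * (c * c).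
  rewrite [LHS]mxE; congr (_ + _); rewrite [LHS]mxE; congr (- _).
  by rewrite [LHS]mxE; congr (_ * _); rewrite [LHS]mxE.
by field.
Qed.

(** Block Gaussian elimination: the column [b] below the pivot [a] is cleared. *)
Lemma det_schur (R : realType) n (a : R) (b : 'cV[R]_n) (B : 'M[R]_n) :
  a != 0 -> \det (block_mx a%:M b^T b B) = a * \det (schur a b B).
Proof.
move=> a0.
have -> : block_mx a%:M b^T b B =
    block_mx 1%:M 0 (a^-1 *: b) 1%:M *m block_mx a%:M b^T 0 (schur a b B).
  rewrite mulmx_block !mul1mx !mul0mx !addr0 mul_mx_scalar scalerA.
  by rewrite mulfV// scale1r -scalemxAl /schur addrC subrK.
by rewrite det_mulmx det_lblock det_ublock !det1 !mul1r det_scalar expr1.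
Qed.

Lemma posdef_block (R : realType) n (A : 'M[R]_(1 + n)) : posdef A ->
  exists a b B, [/\ A = block_mx a%:M b^T b B, 0 < a & posdef (schur a b B)].
Proof.
move=> [symA posA]; pose a := A 0 0; pose b := dlsubmx A; pose B := drsubmx A.
have Ablk : A = block_mx a%:M b^T b B.
  rewrite -[LHS]submxK; congr block_mx.
    rewrite [LHS]mx11_scalar; congr (_%:M).
    by rewrite !mxE; congr (A _ _); apply/val_inj.
  by rewrite /b trmx_dlsub symA.
have symB : B^T = B by rewrite /B trmx_drsub symA.
exists a, b, B; rewrite -Ablk.
have a0 : 0 < a.
  (* The first basis vector isolates the corner entry. *)
  have : col_mx 1%:M (0 : 'cV[R]_n) != 0.
    apply/eqP => /(congr1 usubmx); rewrite col_mxKu linear0 => /matrixP /(_ 0 0).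
    by rewrite !mxE => /eqP; rewrite oner_eq0.
  move=> /posA; rewrite {1}Ablk quad_block.
  by rewrite !mulmx0 !mxE expr1n !mulr1 mulr0 !addr0.
split => //; split.
  by rewrite /schur linearB linearZ /= trmx_mul trmxK symB.
(* This [z] annihilates the square in [schurE], leaving the form of the Schur complement. *)
move=> u u0; pose z := - ((b^T *m u) 0 0 / a).
have /posA : col_mx z%:M u != 0.
  apply: contra_neq u0 => /(congr1 dsubmx).
  by rewrite col_mxKd linear0.
by rewrite {1}Ablk schurE ?gt_eqF// /z addNr expr0n mulr0 add0r.
Qed.

Lemma posdef_det_gt0 (R : realType) n (A : 'M[R]_n) : posdef A -> 0 < \det A.
Proof.
elim: n A => [|n IHn] A pA; first by rewrite det_mx00.
have [a [b [B [-> a0 pS]]]] := @posdef_block R n A pA.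
by rewrite det_schur ?gt_eqF// mulr_gt0// IHn.
Qed.

(** The integrand is a multiple of the normal density of mean [m] and variance [a^-1]. *)
Lemma gauss_integral1 (R : realType) (a m q : R) : 0 < a ->
  (\int[lebesgue_measure]_x (expR (- (a * (x - m) ^+ 2 + q) / 2))%:E)%E =
    (Num.sqrt (2 * pi / a) * expR (- q / 2))%:E.
Proof.
move=> a0; pose s := Num.sqrt a^-1.
have s2 : s ^+ 2 = a^-1 by rewrite sqr_sqrtr// invr_ge0 ltW.
have s0 : s != 0 by rewrite gt_eqF// sqrtr_gt0 invr_gt0.
have an0 : a != 0 by rewrite gt_eqF.
have k0 : Num.sqrt (2 * pi / a) != 0.
  by rewrite gt_eqF// sqrtr_gt0 divr_gt0// mulr_gt0// pi_gt0.
pose k := Num.sqrt (2 * pi / a) * expR (- q / 2).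
have e x : expR (- (a * (x - m) ^+ 2 + q) / 2) = k * normal_pdf m s x.
  rewrite normal_pdfE// /normal_peak /normal_fun s2 /k.
  have -> : a^-1 * pi *+ 2 = 2 * pi / a by rewrite -mulr_natl; ring.
  rewrite mulrACA mulfV// mul1r -expRD; congr expR.
  by field.
under eq_integral do rewrite e EFinM.
rewrite integralZl//; last exact: integrable_normal_pdf.
by rewrite integral_normal_pdf mule1.
Qed.

Definition col_of (R : realType) n (f : n.-tuple R) : 'cV[R]_n :=
  \col_i tnth f i.

Lemma measurable_quad (R : realType) n (A : 'M[R]_n) (m : 'cV[R]_n) :
  measurable_fun setT (fun f : n.-tuple (measurableTypeR R) =>
    ((col_of f - m)^T *m A *m (col_of f - m)) 0 0).
Proof.
under eq_fun.
  move=> f; rewrite mxE.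
  under eq_bigr => j _ do rewrite mxE big_distrl /=.
  over.
apply: measurable_sum => j; apply: measurable_sum => i.
under eq_fun do rewrite !mxE.
by apply: measurable_funM; [apply: measurable_funM => //|];
  apply: measurable_funB => //; exact: measurable_tnth.
Qed.

(** With the other coordinates fixed, the first is Gaussian of precision [a]. Only its centre
    depends on them, so its integral is a constant factor times the Gaussian of the Schur
    complement. *)
Lemma gauss_integral_n (R : realType) n (A : 'M[R]_n) (m : 'cV[R]_n) :
  posdef A ->
  (\int[lebesgue_n R n]_f
     (expR (- ((col_of f - m)^T *m A *m (col_of f - m)) 0 0 / 2))%:E)%E =
  (Num.sqrt ((2 * pi) ^+ n / \det A))%:E.
Proof.
elim: n A m => [|n IHn] A m pA.
  have e (f : 0.-tuple (measurableTypeR R)) :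
      (expR (- ((col_of f - m)^T *m A *m (col_of f - m)) 0 0 / 2))%:E = 1%E.
    by rewrite mxE big_ord0 oppr0 mul0r expR0.
  under eq_integral do rewrite e.
  by rewrite /= integral_dirac// diracT mul1e det_mx00 expr0 divr1 sqrtr1.
have pA' : @posdef R (1 + n) A by [].
have [a [b [B [AE a0 pS]]]] := @posdef_block R n A pA'.
have dS := posdef_det_gt0 pS.
pose m0 := (m : 'cV[R]_(1 + n)) 0 0; pose m1 := dsubmx (m : 'cV[R]_(1 + n)).
pose h (f : n.+1.-tuple (measurableTypeR R)) :=
  (expR (- ((col_of f - m)^T *m A *m (col_of f - m)) 0 0 / 2))%:E.
have mh : measurable_fun setT h.
  apply/measurable_EFinP; apply: measurableT_comp => //.
  apply: measurable_funM => //; apply: measurableT_comp => //.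
  exact: measurable_quad.
have hE x t : h (consT (x, t)) =
  (expR (- (a * (x - (m0 - (b^T *m (col_of t - m1)) 0 0 / a)) ^+ 2 +
     ((col_of t - m1)^T *m schur a b B *m (col_of t - m1)) 0 0) / 2))%:E.
  have vE : col_of (consT (x, t)) - m = col_mx (x - m0)%:M (col_of t - m1).
    apply/matrixP => i j; rewrite ord1; case: (@split_ordP 1 n i) => k ->.
      rewrite [k]ord1.
      have i0 : lshift n (0 : 'I_1) = ord0 :> 'I_n.+1 by apply/val_inj.
      apply: etrans (esym (col_mxEu _ _ _ _)).
      by rewrite [RHS]mxE mulr1n !mxE i0 tnth_consT unlift_none.
    have i0 : rshift 1 k = lift ord0 k :> 'I_n.+1 by apply/val_inj.
    apply: etrans (esym (col_mxEd _ _ _ _)).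
    by rewrite /m1 !mxE i0 tnth_consT liftK; congr (_ - _).
  rewrite /h vE AE.
  have an0 : a != 0 by rewrite gt_eqF.
  have := schurE (x - m0) b (col_of t - m1) B an0.
  rewrite opprB (addrCA x).
  rewrite (addrC (_ / a)).
  move=> E1.
  exact: (congr1 (fun q => (expR (- q / 2))%:E) E1).
transitivity (\int[(lebesgue_measure \x lebesgue_n R n)%E]_z (h \o @consT R n) z)%E.
  rewrite -[in RHS](preimage_setT (@consT R n)).
  by apply: ge0_integral_pushforward => //; exact: measurable_consT.
rewrite fubini_tonelli2; last 2 first.
- by apply: measurableT_comp => //; exact: measurable_consT.
- by move=> z; rewrite lee_fin expR_ge0.
rewrite /fubini_G.
under eq_integral.
  move=> t _; under eq_integral do rewrite /= hE.
  rewrite gauss_integral1// EFinM; over.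
rewrite ge0_integralZl_EFin//; last first.
  apply/measurable_EFinP; apply: measurableT_comp => //.
  apply: measurable_funM => //; apply: measurableT_comp => //.
  exact: measurable_quad.
rewrite IHn// -EFinM -sqrtrM; last first.
  by rewrite divr_ge0 ?mulr_ge0 ?pi_ge0// ltW.
rewrite AE det_schur ?gt_eqF//; congr (Num.sqrt _)%:E.
by rewrite exprS; field; rewrite !gt_eqF.
Qed.

(** * Quadratic forms and covariance matrices *)

Lemma quadD (R : realType) n (A : 'M[R]_n) (x m : 'cV[R]_n) : A^T = A ->
  ((x + m)^T *m A *m (x + m)) 0 0 =
  (x^T *m A *m x) 0 0 + 2 * (x^T *m (A *m m)) 0 0 + (m^T *m A *m m) 0 0.
Proof.
move=> symA.
have D (X Y : 'M[R]_1) : (X + Y) 0 0 = X 0 0 + Y 0 0 by rewrite mxE.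
rewrite [(x + m)^T]linearD /= mulmxDl mulmxDl !mulmxDr !D mulmxA.
have -> : (m^T *m A *m x) 0 0 = (x^T *m A *m m) 0 0.
  rewrite -[in LHS](trmxK (m^T *m A *m x)) mxE.
  by rewrite !trmx_mul trmxK symA mulmxA.
by ring.
Qed.

Lemma quadZ (R : realType) n (A : 'M[R]_n) (t : R) (x : 'cV[R]_n) :
  ((t *: x)^T *m A *m (t *: x)) 0 0 = t ^+ 2 * (x^T *m A *m x) 0 0.
Proof.
have Z c (X : 'M[R]_1) : (c *: X) 0 0 = c * X 0 0 by rewrite mxE.
by rewrite [(t *: x)^T]linearZ /= -!scalemxAl -scalemxAr !Z mulrA -expr2.
Qed.

Lemma trmx_mul_self_gt0 (R : realType) n (v : 'cV[R]_n) :
  v != 0 -> 0 < (v^T *m v) 0 0.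
Proof.
move=> v0; rewrite mxE lt_neqAle sumr_ge0 ?andbT; last first.
  by move=> i _; rewrite mxE -expr2 sqr_ge0.
apply: contra_neq v0 => /esym/eqP; rewrite psumr_eq0; last first.
  by move=> i _; rewrite mxE -expr2 sqr_ge0.
move=> /allP v0; apply/matrixP => i j; rewrite ord1 [RHS]mxE.
have := v0 i (mem_index_enum _); rewrite mxE -expr2 sqrf_eq0.
by move=> /eqP.
Qed.

(** If [u = invmx S *m v] were isotropic for [S], the form at [t *: v + u] would be
    [t ^+ 2 * q + 2 * t * c] with [c > 0], negative for small negative [t]. *)
Lemma covariance_mx_inv_posdef (R : realType) n (S : 'M[R]_n) :
  covariance_mx S -> S \in unitmx -> posdef (invmx S).
Proof.
move=> [symS S0] uS; have symV : (invmx S)^T = invmx S by rewrite trmx_inv symS.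
split => // v v0; pose u := invmx S *m v.
have Su : S *m u = v by rewrite mulmxA mulmxV// mul1mx.
have -> : v^T *m invmx S *m v = u^T *m S *m u.
  by rewrite trmx_mul symV -[RHS]mulmxA Su.
rewrite lt_neqAle S0 andbT; apply/eqP => /esym uSu.
pose c := (v^T *m v) 0 0; have c0 : 0 < c by exact: trmx_mul_self_gt0.
pose q := (v^T *m S *m v) 0 0; have q0 : 0 <= q by exact: S0.
(* The denominator [1 + q] stays positive even when [q = 0]. *)
have := S0 (- c / (1 + q) *: v + u).
rewrite quadD// uSu addr0 quadZ -/q Su [(_ *: v)^T]linearZ /= -scalemxAl.
have -> : ((- c / (1 + q)) *: (v^T *m v)) 0 0 = - c / (1 + q) * c by rewrite [LHS]mxE.
have q10 : 0 < 1 + q by rewrite ltr_pwDl.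
have -> : (- c / (1 + q)) ^+ 2 * q + 2 * (- c / (1 + q) * c) =
    - (c ^+ 2 * (2 + q) / (1 + q) ^+ 2) by field; rewrite gt_eqF.
rewrite oppr_ge0 leNgt divr_gt0 ?exprn_gt0// mulr_gt0 ?exprn_gt0//.
by rewrite ltr_pwDl.
Qed.

Lemma posdef_unitmx (R : realType) n (A : 'M[R]_n) : posdef A -> A \in unitmx.
Proof. by move=> /posdef_det_gt0 dA; rewrite unitmxE unitfE gt_eqF. Qed.

Lemma posdef_inv_covariance_mx (R : realType) n (A : 'M[R]_n) :
  posdef A -> covariance_mx (invmx A).
Proof.
move=> pA; have uA := posdef_unitmx pA; have [symA posA] := pA.
have symV : (invmx A)^T = invmx A by rewrite trmx_inv symA.
split => // v; pose u := invmx A *m v.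
have Au : A *m u = v by rewrite mulmxA mulmxV// mul1mx.
have -> : v^T *m invmx A *m v = u^T *m A *m u.
  by rewrite trmx_mul symV -[RHS]mulmxA Au.
have [->|u0] := eqVneq u 0; first by rewrite mulmx0 mxE.
exact/ltW/posA.
Qed.

Lemma quad_diag (R : realType) n (d : 'rV[R]_n) (v : 'cV[R]_n) :
  (v^T *m diag_mx d *m v) 0 0 = \sum_i d 0 i * v i 0 ^+ 2.
Proof.
rewrite mxE; apply: eq_bigr => i _; rewrite mul_mx_diag !mxE.
by ring.
Qed.

Lemma posdefD_diag (R : realType) n (A : 'M[R]_n) (d : 'rV[R]_n) :
  posdef A -> (forall i, 0 <= d 0 i) -> posdef (A + diag_mx d).
Proof.
move=> [symA posA] d0; split; first by rewrite linearD /= symA tr_diag_mx.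
move=> v v0; rewrite mulmxDr mulmxDl mxE quad_diag ltr_pwDl ?posA//.
by apply: sumr_ge0 => i _; rewrite mulr_ge0 ?sqr_ge0.
Qed.

(** * Normalization and tilting of Gaussian densities *)

Lemma gaussian_norm_gt0 (R : realType) n (A : 'M[R]_n) : posdef A ->
  0 < Num.sqrt ((2 * pi) ^+ n * \det (invmx A)).
Proof.
move=> /posdef_det_gt0 dA; rewrite sqrtr_gt0 det_inv mulr_gt0 ?invr_gt0//.
by rewrite exprn_gt0// mulr_gt0// pi_gt0.
Qed.

Lemma gaussian_pdf_gt0 (R : realType) n (A : 'M[R]_n) (m : 'cV[R]_n)
    (f : n.-tuple R) :
  posdef A -> 0 < gaussian_pdf m (invmx A) f.
Proof.
by move=> pA; rewrite /gaussian_pdf divr_gt0 ?expR_gt0 ?gaussian_norm_gt0.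
Qed.

Lemma gaussian_pdfE (R : realType) n (A : 'M[R]_n) (m : 'cV[R]_n)
    (f : n.-tuple R) :
  gaussian_pdf m (invmx A) f =
  (Num.sqrt ((2 * pi) ^+ n * \det (invmx A)))^-1 *
  expR (- ((col_of f - m)^T *m A *m (col_of f - m)) 0 0 / 2).
Proof. by rewrite /gaussian_pdf invmxK mulrC. Qed.

Lemma measurable_gaussian_pdf (R : realType) n (A : 'M[R]_n) (m : 'cV[R]_n) :
  measurable_fun setT
    (gaussian_pdf m (invmx A) : n.-tuple (measurableTypeR R) -> R).
Proof.
rewrite (_ : gaussian_pdf _ _ = fun f : n.-tuple (measurableTypeR R) =>
  (Num.sqrt ((2 * pi) ^+ n * \det (invmx A)))^-1 *
  expR (- ((col_of f - m)^T *m A *m (col_of f - m)) 0 0 / 2)); last first.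
  by apply/funext => f; exact: gaussian_pdfE.
apply: measurable_funM => //; apply: measurableT_comp => //.
apply: measurable_funM => //; apply: measurableT_comp => //.
exact: measurable_quad.
Qed.

Lemma integral_gaussian_pdf (R : realType) n (A : 'M[R]_n) (m : 'cV[R]_n) :
  posdef A ->
  (\int[lebesgue_n R n]_f (gaussian_pdf m (invmx A) f)%:E = 1)%E.
Proof.
move=> pA; have N0 := gaussian_norm_gt0 pA.
under eq_integral do rewrite gaussian_pdfE EFinM.
rewrite ge0_integralZl_EFin//; last first.
  apply/measurable_EFinP; apply: measurableT_comp => //.
  apply: measurable_funM => //; apply: measurableT_comp => //.
  exact: measurable_quad.
rewrite gauss_integral_n// -det_inv -EFinM mulVf// gt_eqF//.
Qed.

Lemma integrable_gaussian_pdf (R : realType) n (A : 'M[R]_n) (m : 'cV[R]_n) :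
  posdef A ->
  (lebesgue_n R n).-integrable setT (EFin \o gaussian_pdf m (invmx A)).
Proof.
move=> pA; apply/integrableP; split.
  by apply/measurable_EFinP; exact: measurable_gaussian_pdf.
have -> : (\int[lebesgue_n R n]_f `|(EFin \o gaussian_pdf m (invmx A)) f| = 1)%E.
  rewrite -(integral_gaussian_pdf m pA); apply: eq_integral => f _ /=.
  by rewrite gtr0_norm// gaussian_pdf_gt0.
exact: ltry.
Qed.

(** The Gaussian density integrates to 1, so the normalizing integral is [k] itself and cancels. *)
Lemma conditional_f_gaussian (R : realType) n (A : 'M[R]_n) (m : 'cV[R]_n)
    (joint : n.-tuple R -> n.-tuple R -> R) (w : n.-tuple R) (k : R) :
  posdef A -> k != 0 ->
  (forall f, joint f w = k * gaussian_pdf m (invmx A) f) ->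
  gaussian_family (conditional_f joint w).
Proof.
move=> pA k0 jE; exists m, (invmx A); split.
- exact: posdef_inv_covariance_mx.
- by rewrite unitmx_inv posdef_unitmx.
move=> f; rewrite /conditional_f jE.
have -> : \int[lebesgue_n R n]_f' joint f' w = k.
  transitivity (\int[lebesgue_n R n]_f' (k * gaussian_pdf m (invmx A) f')).
    by apply: eq_Rintegral => f' _; exact: jE.
  rewrite RintegralZl//; last exact: integrable_gaussian_pdf.
  by rewrite /Rintegral integral_gaussian_pdf// mulr1.
by rewrite mulrC mulKf.
Qed.

(* Completing the square in the exponent of the joint density of [f]. *)
Lemma gaussian_pdf_tilt (R : realType) n (A : 'M[R]_n) (d b : 'rV[R]_n)
    (mu : 'cV[R]_n) : posdef A -> (forall i, 0 <= d 0 i) ->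
  exists m B k, [/\ posdef B, k != 0 & forall f : n.-tuple R,
    expR (\sum_i (b 0 i * tnth f i - d 0 i * tnth f i ^+ 2)) *
      gaussian_pdf mu (invmx A) f = k * gaussian_pdf m (invmx B) f].
Proof.
(* The diagonal form enters the exponent without the factor 1/2 of the Gaussian density, hence the
   2. *)
move=> pA d0; pose B := A + 2 *: diag_mx d.
have pB : posdef B.
  rewrite /B -linearZ; apply: posdefD_diag => // i.
  by rewrite mxE mulr_ge0.
have [symA _] := pA; have [symB _] := pB; have uB := posdef_unitmx pB.
(* This mean matches the terms linear in [f]. *)
pose m := invmx B *m (A *m mu + b^T).
have Bm : B *m m = A *m mu + b^T by rewrite mulmxA mulmxV// mul1mx.
have NA := gaussian_norm_gt0 pA; have NB := gaussian_norm_gt0 pB.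
(* What is left of the exponent once the square is completed, free of [f]. *)
pose e := ((m^T *m B *m m) 0 0 - (mu^T *m A *m mu) 0 0) / 2.
exists m, B, (Num.sqrt ((2 * pi) ^+ n * \det (invmx B)) *
  (Num.sqrt ((2 * pi) ^+ n * \det (invmx A)))^-1 * expR e); split => //.
  by rewrite gt_eqF// !mulr_gt0 ?invr_gt0 ?expR_gt0.
move=> f; rewrite !gaussian_pdfE.
set NB' := Num.sqrt _ in NB *; set NA' := Num.sqrt _ in NA *.
rewrite [LHS]mulrCA -expRD [RHS]mulrACA.
have -> : NB' / NA' * NB'^-1 = NA'^-1 by rewrite mulrAC mulfV ?gt_eqF// mul1r.
rewrite -expRD; congr (_ * expR _).
have Nq (M : 'M[R]_n) (x : 'cV[R]_n) :
    ((- x)^T *m M *m (- x)) 0 0 = (x^T *m M *m x) 0 0.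
  by rewrite [(- x)^T]linearN /= mulNmx mulNmx mulmxN opprK.
have N (X : 'M[R]_1) : (- X) 0 0 = - X 0 0 by rewrite mxE.
have D (X Y : 'M[R]_1) : (X + Y) 0 0 = X 0 0 + Y 0 0 by rewrite mxE.
set x := col_of f; rewrite !quadD// !Nq !mulmxN !N Bm.
rewrite [x^T *m (A *m mu + _)]mulmxDr D.
have -> : (x^T *m B *m x) 0 0 =
    (x^T *m A *m x) 0 0 + 2 * \sum_i d 0 i * tnth f i ^+ 2.
  rewrite /B mulmxDr mulmxDl D -linearZ quad_diag; congr (_ + _).
  rewrite mulr_sumr; apply: eq_bigr => i _; rewrite !mxE.
  by rewrite mulrA.
have -> : (x^T *m b^T) 0 0 = \sum_i b 0 i * tnth f i.
  by rewrite mxE; apply: eq_bigr => i _; rewrite !mxE mulrC.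
rewrite sumrB /e; by field.
Qed.

(** Serves twice: with [k = 1] for the marginal likelihood, and with [k] the prior density at [f]
    for the complete conditional. In the quotient [k] and all the [c i] cancel. *)
Lemma conditional_w_tilted (R : realType) n (phi p : R -> R)
    (joint : n.-tuple R -> n.-tuple R -> R) (f : n.-tuple R)
    (c r : 'I_n -> R) (k : R) :
  positive_definite_radial phi -> is_inverse_laplace phi p ->
  k != 0 -> (forall i, c i != 0) -> (forall i, 0 <= r i) ->
  (forall w, joint f w =
     k * \prod_i (c i * (expR (- (r i * tnth w i)) * p (tnth w i)))) ->
  (\int[lebesgue_n R n]_(w in @orthant R n) (joint f w)%:E)%E =
    (k * \prod_i (c i * phi (r i)))%:E /\
  tilted_family phi p (conditional_w joint f).
Proof.
move=> phi_pdr pinv k0 c0 r0 jE.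
have phi0 i : phi (r i) != 0 by rewrite gt_eqF// positive_definite_radial_gt0.
have int : (\int[lebesgue_n R n]_(w in @orthant R n) (joint f w)%:E)%E =
    (k * \prod_i (c i * phi (r i)))%:E.
  under eq_integral do rewrite jE.
  apply: (@lebesgue_n_prod_orthant R n
    (fun i x => c i * (expR (- (r i * x)) * p x))) => i.
    have [ip _] := inverse_laplace_ge0 phi_pdr pinv (r0 i).
    apply: (@eq_integrable _ _ _ _ _ _ _ _ _ (integrableZl _ (c i) ip)) => //.
  have [ip e] := inverse_laplace_ge0 phi_pdr pinv (r0 i).
  under eq_integral do rewrite EFinM.
  by rewrite integralZl// e.
(* A tilting parameter acts through its square. *)
split => //; exists (fun i => Num.sqrt (r i)) => w _.
rewrite /conditional_w /Rintegral int jE /=.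
rewrite -mulf_div divff// mul1r -prodf_div; apply: eq_bigr => i _.
by rewrite /tilted sqr_sqrtr// -mulf_div divff// mul1r.
Qed.

Theorem theorem1 (R : realType) (n d : nat) (Theta : Type) (theta : Theta)
    (C : Theta -> R) (g alpha beta gamma : R -> Theta -> R)
    (h : Theta -> R -> R -> 'rV[R]_d) (phi : R -> R)
    (nu : {measure set (measurableTypeR R) -> \bar R})
    (mu0 : 'cV[R]_n) (K : 'M[R]_n) (pi0 : R -> R) (y : n.-tuple R)
    (phi_pdr : positive_definite_radial phi)
    (h_linear : exists a b : R -> 'rV[R]_d,
       forall fi yi, h theta fi yi = a yi + fi *: b yi)
    (h_norm : forall fi yi, sqnorm2 (h theta fi yi) =
       alpha yi theta - beta yi theta * fi + gamma yi theta * fi ^+ 2)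
    (C_normalizing : forall fi,
       (\int[nu]_yi (likelihood1 C g h phi theta fi yi)%:E = 1)%E)
    (K_cov : covariance_mx K) (K_unit : K \in unitmx)
    (pi0_inv : is_inverse_laplace phi pi0) :
  [/\ is_half_line_pdf pi0,
      forall f : n.-tuple R,
        (\int[lebesgue_n R n]_(w in @orthant R n)
            (augmented_likelihood C g h theta y f w * aux_prior pi0 w)%:E
         = (likelihood C g h phi theta y f)%:E)%E
    & conditionally_conjugate (@gaussian_family R n)
        (tilted_family phi pi0) (gaussian_pdf mu0 K) (aux_prior pi0)
        (augmented_joint C g h pi0 mu0 K theta y)].
Proof.
have pi0_pdf := inverse_laplace_pdf phi_pdr pi0_inv.
(* A zero constant would make the likelihood integrate to 0 instead of 1. *)
have C0 : C theta != 0.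
  apply/eqP => C0; have := C_normalizing 0; rewrite /likelihood1 C0.
  under eq_integral do rewrite !mul0r.
  by rewrite integral0 => /eqP; rewrite eqe eq_sym oner_eq0.
(* As [h] is affine in [fi] with slope [b yi], the second difference of its squared norm over
   [-1, 0, 1] identifies [gamma yi theta] with [sqnorm2 (b yi)]. *)
have gamma0 yi : 0 <= gamma yi theta.
  have [a [b hE]] := h_linear.
  suff : 2 * gamma yi theta = 2 * sqnorm2 (b yi).
    by move=> /mulfI ->//; apply: sumr_ge0 => j _; exact: sqr_ge0.
  transitivity (sqnorm2 (h theta 1 yi) + sqnorm2 (h theta (-1) yi) -
      2 * sqnorm2 (h theta 0 yi)).
    by rewrite !h_norm; ring.
  rewrite /sqnorm2 -big_split /= !mulr_sumr -sumrB; apply: eq_bigr => j _.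
  by rewrite !hE !mxE; ring.
pose r (f : n.-tuple R) i := sqnorm2 (h theta (tnth f i) (tnth y i)).
have r0 f i : 0 <= r f i by apply: sumr_ge0 => j _; exact: sqr_ge0.
pose c (f : n.-tuple R) i := C theta * expR (g (tnth y i) theta * tnth f i).
have c0 f i : c f i != 0 by rewrite mulf_neq0// gt_eqF// expR_gt0.
have augE f w : augmented_likelihood C g h theta y f w * aux_prior pi0 w =
    \prod_i (c f i * (expR (- (r f i * tnth w i)) * pi0 (tnth w i))).
  rewrite -big_split; apply: eq_bigr => i _ /=.
  by rewrite /c /r expRD !mulrA.
pose A := invmx K; have pA : posdef A by exact: covariance_mx_inv_posdef.
have KE : K = invmx A by rewrite invmxK.
split => //.
  move=> f.
  have [|] := @conditional_w_tilted R n phi pi0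
    (fun f w => augmented_likelihood C g h theta y f w * aux_prior pi0 w)
    f (c f) (r f) 1 phi_pdr pi0_inv (oner_neq0 R) (c0 f) (r0 f).
    by move=> w; rewrite mul1r augE.
  by move=> -> _; rewrite mul1r.
split.
- by exists mu0, K.
(* The prior is the untilted member of the family, because [phi 0 = 1]. *)
- exists (fun=> 0) => w _; apply: eq_bigr => i _.
  rewrite /tilted expr0n /= mul0r oppr0 expR0 mul1r.
  by rewrite (positive_definite_radial0 phi_pdr) divr1.
- move=> w w0 pw0.
  (* Once [h_norm] is expanded, the exponent has quadratic coefficients [- q] and linear
     coefficients [b] in [f]; the [alpha] terms are free of [f] and go into [k']. *)
  pose q : 'rV[R]_n := \row_i (gamma (tnth y i) theta * tnth w i).
  pose b : 'rV[R]_n :=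
    \row_i (g (tnth y i) theta + beta (tnth y i) theta * tnth w i).
  have q0 i : 0 <= q 0 i by rewrite mxE mulr_ge0.
  have [m [B [k [pB k0 kE]]]] := @gaussian_pdf_tilt R n A q b mu0 pA q0.
  pose k' := C theta ^+ n *
    expR (- \sum_i alpha (tnth y i) theta * tnth w i) * aux_prior pi0 w.
  apply: (@conditional_f_gaussian R n B m _ w (k' * k)) => //.
    (* Positivity of the prior density at [w] makes the constant nonzero. *)
    rewrite mulf_neq0// /k' mulf_neq0 ?(gt_eqF pw0)//.
    by rewrite mulf_neq0 ?expf_neq0// gt_eqF// expR_gt0.
  move=> f; rewrite -mulrA -kE -KE /augmented_joint /k'.
  rewrite (_ : augmented_likelihood _ _ _ _ _ _ _ = C theta ^+ n *
      (expR (- \sum_i alpha (tnth y i) theta * tnth w i) *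
       expR (\sum_i (b 0 i * tnth f i - q 0 i * tnth f i ^+ 2)))).
    by ring.
  rewrite -expRD /augmented_likelihood big_split /= prodr_const card_ord.
  rewrite -expR_sum -sumrN -big_split /=; congr (_ * expR _).
  by apply: eq_bigr => i _; rewrite !mxE h_norm; ring.
move=> f.
(* The Gaussian prior density at [f] is positive and constant in [w]. *)
have [] := @conditional_w_tilted R n phi pi0
  (augmented_joint C g h pi0 mu0 K theta y) f (c f) (r f)
  (gaussian_pdf mu0 K f) phi_pdr pi0_inv _ (c0 f) (r0 f) => //.
- by rewrite gt_eqF// KE gaussian_pdf_gt0.
- by move=> w; rewrite /augmented_joint mulrAC augE mulrC.
Qed.
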